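(* Let $\psi \colon \mathbb{N} \to (0,\infty)$ be a function such that (i) $\psi(n+1)-\psi(n) \to 0$ as $n \to \infty$, and (ii) $e^{pn}\psi(n) \to \infty$ as $n \to \infty$ for any positive real number $p$. For each $\beta \in [-\infty,\infty]$, let $$C(\psi,\beta) := \left\{ x \in (0,1] : \lim_{n\to\infty} \frac{\log d_n(x) - n}{\psi(n)} = \beta \right\}.$$ Then, for each $\beta \in [-\infty,\infty]$, $\dim_H C(\psi,\beta) = 1$.
   Context: Pierce expansion digits: for $x \in (0,1]$ put $d_1(x) := \lfloor 1/x \rfloor$ and $T(x) := 1 - d_1(x)x$, and for $k \in \mathbb{N}$ put $d_k(x) := d_1(T^{k-1}(x))$ provided $T^{k-1}(x) \neq 0$. All digits $d_k(x)$, $k \in \mathbb{N}$, are defined exactly when $x$ is irrational, and then they form a strictly increasing sequence of positive integers. Convention: a limiting condition on $(d_n(x))_n$, or a condition for all (large) $n$, is only considered for irrational $x$, so rational $x$ do not belong to sets defined by such conditions. $\mathbb{N}=\{1,2,\dots\}$, $\log$ is the natural logarithm, and $\dim_H$ is the Hausdorff dimension. *)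

(* Defs.v *)
From mathcomp Require Import all_boot all_order all_algebra.
From mathcomp Require Import all_classical all_reals all_analysis.
Import Order.TTheory GRing.Theory Num.Theory numFieldNormedType.Exports.

Set Implicit Arguments.
Unset Strict Implicit.
Unset Printing Implicit Defensive.

Local Open Scope classical_set_scope.
Local Open Scope ring_scope.

Definition pierce_digit1 (R : realType) (x : R) : int := Num.floor (1 / x).

Definition pierce_map (R : realType) (x : R) : R :=
  1 - (pierce_digit1 x)%:~R * x.

(* Digits are numbered from 1, so [pierce_digit 0] is junk.  The digits of a
   rational [x] are junk from some index on, because of [1 / 0 = 0]: sets
   defined through all the digits must be restricted to irrational [x]. *)
Definition pierce_digit (R : realType) (k : nat) (x : R) : int :=
  pierce_digit1 (iter k.-1 (@pierce_map R) x).

(* [0] is added to the set so that [diam set0 = 0]. *)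
Definition diam (R : realType) (A : set R) : \bar R :=
  ereal_sup (0%E |` [set `|x - y|%:E | x in A & y in A]).

(* The empty set has weight [0] also for [s = 0], where [0 `^ 0 = 1]. *)
Definition hausdorff_gauge (R : realType) (s : R) (A : set R) : \bar R :=
  if A == set0 then 0%E else (diam A `^ s)%E.

Definition hausdorff_content (R : realType) (s delta : R) (A : set R) :
    \bar R :=
  ereal_inf [set (\sum_(0 <= i <oo) hausdorff_gauge s (U i))%E |
    U in [set U : (set R)^nat |
      A `<=` \bigcup_i U i /\ forall i, (diam (U i) <= delta%:E)%E]].

(* The contents increase as [delta] decreases, so that the supremum is the
   limit as [delta] tends to [0]. *)
Definition hausdorff_measure (R : realType) (s : R) (A : set R) : \bar R :=
  ereal_sup [set hausdorff_content s delta A | delta in [set delta | 0 < delta]].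

Definition hausdorff_dim (R : realType) (A : set R) : \bar R :=
  ereal_inf [set s%:E | s in [set s : R | 0 <= s /\ hausdorff_measure s A = 0%E]].

Definition pierce_growth_set (R : realType) (psi : nat -> R) (beta : \bar R) :
    set R :=
  [set x : R | [/\ 0 < x <= 1, irrational x &
    ((ln (pierce_digit n x)%:~R - n%:R) / psi n)%:E @[n --> \oo] --> beta]].

(* Main.v *)
Require Import Defs.
From mathcomp Require Import all_boot all_order all_algebra.
From mathcomp Require Import all_classical all_reals all_analysis.
From mathcomp Require Import ring lra.
Import Order.TTheory GRing.Theory Num.Theory numFieldNormedType.Exports.

(** The dimension is at most [1] because the set lies in the unit interval.
For the lower bound, a Cantor set of dimension [1] is found inside it.

Take first a finite [beta] and put [t n = n + beta * psi n].  Every irrational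
[x] whose [n]-th digit lies in the window from [expR (t n)] to
[expR (t n) * (1 + psi n / n)], for all large [n], belongs to the growth set,
since the relative width [psi n / n] is negligible with respect to [psi n].
As [psi] has increments tending to [0], [t n.+1 - t n] tends to [1]; so
consecutive windows move up by a factor close to [e > 2], they are disjoint,
and any choice of one integer in each window is the digit sequence of some
irrational number.  The assumption that [psi] decays subexponentially says
that the [n]-th window contains [e ^ (n - o(n))] integers: to first order in
the exponent, the full number of integers below [e ^ n].

The choices are coded by [0, 1[: the mixed radix digits of [u], with radix
[m n] the number of integers in the [n]-th window, select the digits of a point
[G u] ([radix_digit], [pierce_sum]).  If the codes of [u] and [v] first differ
at place [n], then [`|u - v|] is at most [1 / (m 0 * ... * m (n - 1))]
([radix_digit_close]), while [G u] and [G v] are at distance at least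
[1 / (2 * b n ^ 2 * b 0 * ... * b (n - 1))], where [b] bounds the digits
([pierce_sum_sep]; the factor [2] between windows is what keeps neighbouring
cylinders apart).  Since [m n] exceeds every power [b n ^ p] with [p < 1],
the first bound is at most a constant times the [p]-th power of the second,
so the inverse of [G] is Hoelder continuous of every exponent [p < 1]
([pierce_window_measure_gt0]).  A cover of the image of [G] by small sets [U]
then yields a cover of [0, 1[ by intervals of length proportional to
[diam U ^ p], and countable subadditivity of Lebesgue measure bounds the
Hausdorff measure from below ([hausdorff_measure_gt0]).

For an infinite [beta], there is a sequence [phi] that satisfies the same
hypotheses and grows faster than [psi] ([exists_faster_slow_sequence]); the
growth sets of [phi] for the values [1] and [-1] are then contained in those of
[psi] for [+oo] and [-oo]. *)

Local Open Scope classical_set_scope.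
Local Open Scope ring_scope.

(** * Hausdorff measure *)

Lemma diam_ge0 (R : realType) (A : set R) : (0 <= diam A)%E.
Proof. by apply: ereal_sup_ubound; left. Qed.

Lemma dist_le_diam (R : realType) (A : set R) (x y : R) :
  A x -> A y -> (`|x - y|%:E <= diam A)%E.
Proof. by move=> Ax Ay; apply: ereal_sup_ubound; right; exists x => //; exists y. Qed.

Lemma diam_le (R : realType) (A : set R) (r : R) : 0 <= r ->
  (forall x y, A x -> A y -> `|x - y| <= r) -> (diam A <= r%:E)%E.
Proof.
move=> r0 Ar; apply: ge_ereal_sup => _ [->|[x Ax [y Ay <-]]]; rewrite lee_fin //.
exact: Ar.
Qed.

Lemma hausdorff_gauge_ge0 (R : realType) (s : R) (A : set R) :
  (0 <= hausdorff_gauge s A)%E.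
Proof. by rewrite /hausdorff_gauge; case: ifP => // _; exact: poweR_ge0. Qed.

Lemma hausdorff_content_ge0 (R : realType) (s delta : R) (A : set R) :
  (0 <= hausdorff_content s delta A)%E.
Proof.
apply: le_ereal_inf_tmp => _ [U _ <-]; apply: nneseries_ge0 => n _ _.
exact: hausdorff_gauge_ge0.
Qed.

Lemma le_hausdorff_measure (R : realType) (s : R) (A B : set R) :
  A `<=` B -> (hausdorff_measure s A <= hausdorff_measure s B)%E.
Proof.
move=> AB; apply: ge_ereal_sup => _ [d d0 <-].
apply: (@le_trans _ _ (hausdorff_content s d B)); last first.
  by apply: ereal_sup_ubound; exists d.
apply: ereal_inf_le_tmp => _ [U [BU Ud] <-]; exists U => //.
by split=> //; exact: subset_trans BU.
Qed.

Lemma le_hausdorff_dim (R : realType) (A B : set R) :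
  A `<=` B -> (hausdorff_dim A <= hausdorff_dim B)%E.
Proof.
move=> AB; apply: ereal_inf_le_tmp => _ [s [s0 sB] <-]; exists s => //; split=> //.
apply/eqP; rewrite eq_le; apply/andP; split.
  by rewrite -sB; exact: le_hausdorff_measure.
apply: (@le_trans _ _ (hausdorff_content s 1 A)); first exact: hausdorff_content_ge0.
by apply: ereal_sup_ubound; exists 1 => //=.
Qed.

(** A form of the mass distribution principle in which the mass is Lebesgue
measure on [0, 1[, transported by a map [G] whose inverse is Hoelder continuous
of exponent [s]: the preimage of a set [U] lies in an interval of length
[2 * C * diam U ^ s], and these lengths add up to at least [1] over a cover. *)
Lemma hausdorff_measure_gt0 (R : realType) (A : set R) (s C : R) (G : R -> R) :
  0 <= s -> 0 < C -> (forall u, 0 <= u < 1 -> A (G u)) ->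
  (forall u v, 0 <= u < 1 -> 0 <= v < 1 -> `|u - v| <= C * `|G u - G v| `^ s) ->
  (0 < hausdorff_measure s A)%E.
Proof.
move=> s0 C0 GA GC.
apply: (@lt_le_trans _ _ (hausdorff_content s 1 A)); last first.
  by apply: ereal_sup_ubound; exists 1 => //=.
apply: (@lt_le_trans _ _ ((2 * C)^-1)%:E).
  by rewrite lte_fin invr_gt0 mulr_gt0.
apply: le_ereal_inf_tmp => _ [U [AU U1] <-].
pose r i := C * (fine (diam (U i))) `^ s.
have Ufin i : diam (U i) \is a fin_num.
  rewrite ge0_fin_numE ?diam_ge0 //; exact: le_lt_trans (U1 i) (ltry _).
have /choice[I HI] : forall i, exists J : set R, [/\ measurable J,
    (forall u, 0 <= u < 1 -> U i (G u) -> J u) &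
    (lebesgue_measure J <= (2 * C)%:E * hausdorff_gauge s (U i))%E].
  move=> i.
  have [[u0 [u01 Uu0]]|nou] := pselect (exists u, 0 <= u < 1 /\ U i (G u)).
    (* Any point [u0] of the preimage can serve as a centre: all the others are
       within [C * diam (U i) ^ s] of it. *)
    exists `[u0 - r i, u0 + r i]%classic; split=> //.
    - move=> u u1 Uu; rewrite /= in_itv /=.
      have : `|u - u0| <= r i.
        apply: le_trans (GC _ _ u1 u01) _; rewrite ler_pM2l //.
        apply: ge0_ler_powR; rewrite ?nnegrE ?fine_ge0 ?diam_ge0 //.
        by rewrite -lee_fin fineK //; exact: dist_le_diam.
      by rewrite ler_norml; lra.
    - have r0 : 0 <= r i by rewrite mulr_ge0 ?powR_ge0 // ltW.
      have Une : (U i == set0) = false.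
        by apply/negP => /eqP U0; move: Uu0; rewrite U0.
      rewrite lebesgue_measure_itv /hausdorff_gauge Une.
      rewrite -(fineK (Ufin i)) poweR_EFin -EFinM -mulrA -/(r i).
      by case: ifP => _; rewrite ?lee_fin; rewrite -?EFinB ?lee_fin; lra.
  exists set0; split => //.
  - by move=> u u1 Uu; apply: nou; exists u.
  - rewrite measure0 mule_ge0 ?hausdorff_gauge_ge0 //.
    by rewrite lee_fin mulr_ge0 // ltW.
have cov : [set` `[(0:R), 1[] `<=` \bigcup_i I i.
  move=> u; rewrite /= in_itv /= => u01; have [i _ Ui] := AU _ (GA _ u01).
  by exists i => //; have [_ H _] := HI i; exact: H.
have H : (lebesgue_measure [set` `[0%R : R, 1%R[] <=
    \sum_(0 <= i <oo) lebesgue_measure (I i))%E.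
  have := @measure_sigma_subadditive _ _ _ (@lebesgue_measure R) [set` `[0%R : R, 1%R[] I.
  apply; [by move=> i; have [] := HI i | exact: measurable_itv | exact: cov].
rewrite lebesgue_measure_itv /= lte_fin ltr01 oppr0 adde0 in H.
have : (1 <= \sum_(0 <= i <oo) ((2 * C)%:E * hausdorff_gauge s (U i)))%E.
  apply: le_trans H _; apply: lee_nneseries => // i _.
  by have [_ _] := HI i.
rewrite nneseriesZl => [H1|i _]; last exact: hausdorff_gauge_ge0.
have C2 : 0 < 2 * C by rewrite mulr_gt0.
have := lee_wpmul2l _ H1.
move=> /(_ (2 * C)^-1%:E); rewrite lee_fin invr_ge0 ltW // => /(_ isT).
by rewrite mule1 muleA -EFinM mulVf ?gt_eqF // mul1e.
Qed.

(** Slabs of width [1 / n] cover [A], and [n + 1] of them have total weight of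
order [n ^ (1 - s)], which tends to [0]. *)
Lemma hausdorff_measure_sub01_eq0 (R : realType) (A : set R) (s : R) :
  A `<=` [set x | 0 <= x <= 1] -> 1 < s -> hausdorff_measure s A = 0%E.
Proof.
move=> A01 s1.
suff H d : 0 < d -> (hausdorff_content s d A <= 0)%E.
  apply/eqP; rewrite eq_le; apply/andP; split.
    by apply: ge_ereal_sup => _ [d d0 <-]; exact: H.
  apply: (@le_trans _ _ (hausdorff_content s 1 A)); first exact: hausdorff_content_ge0.
  by apply: ereal_sup_ubound; exists 1 => //=.
move=> d0; apply/lee_addgt0Pr => e e0; rewrite add0e.
have [n [n0 nd ne]] : exists n : nat, [/\ (0 < n)%N, n%:R^-1 <= d &
    n%:R * (n%:R^-1) `^ s <= e / 2].
  (* [y] is the solution of [y ^ (s - 1) = e / 2]. *)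
  pose y := (e / 2) `^ (s - 1)^-1.
  have y0 : 0 < y by rewrite powR_gt0 //; lra.
  have my : 0 < Num.min y d by rewrite lt_min y0 d0.
  have /cvgrPdist_le /(_ _ my) [N _ HN] := @cvg_harmonic R.
  exists N.+1.
  have := HN _ (leqnn N); rewrite /= sub0r normrN ger0_norm // le_min.
  set x := _^-1 => /andP[xy xd].
  have x0 : 0 < x by rewrite invr_gt0.
  split=> //.
  have -> : N.+1%:R = x^-1 by rewrite invrK.
  have -> : x `^ s = x * x `^ (s - 1) by rewrite mulr_powRB1 ?ltW //; lra.
  rewrite mulrA mulVf ?gt_eqF // mul1r.
  have -> : e / 2 = y `^ (s - 1).
    by rewrite -powRrM mulVf ?powRr1 //; [lra|rewrite subr_eq0 gt_eqF].
  by apply: ge0_ler_powR => //; rewrite ?nnegrE; lra.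
have n0' : 0 < n%:R :> R by rewrite ltr0n.
(* The slab of index [n] is needed for the point [1]. *)
pose U (i : nat) := if (i <= n)%N then
   A `&` [set x : R | i%:R / n%:R <= x < i.+1%:R / n%:R] else set0.
have Ubig i : (n < i)%N -> U i = set0.
  by rewrite /U ltnNge => /negbTE ->.
have Ud i : (diam (U i) <= (n%:R^-1)%:E)%E.
  apply: diam_le; first by rewrite invr_ge0 ltW.
  move=> x y; rewrite /U; case: ifP => // _ [_ /= x1] [_ /= y1].
  have E : i.+1%:R / n%:R = i%:R / n%:R + n%:R^-1 :> R.
    by rewrite -natr1 mulrDl mul1r.
  by move: x1 y1; rewrite E ler_norml; lra.
have AU : A `<=` \bigcup_i U i.
  move=> x Ax; have /= x01 := A01 _ Ax.
  have nx0 : 0 <= n%:R * x by rewrite mulr_ge0 ?ler0n //; lra.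
  exists (Num.truncn (n%:R * x)) => //; rewrite /U.
  have /andP[t1 t2] := truncn_itv nx0.
  rewrite ifT; last first.
    rewrite -(ler_nat R); apply: le_trans t1 _.
    by rewrite -[leRHS]mulr1 ler_wpM2l ?ler0n //; lra.
  split=> //=; rewrite ler_pdivrMr // ltr_pdivlMr //.
  by rewrite ![x * _]mulrC t1 t2.
apply: (@le_trans _ _ (\sum_(0 <= i <oo) hausdorff_gauge s (U i))%E).
  apply: ereal_inf_lbound; exists U => //; split=> // i.
  by apply: le_trans (Ud i) _; rewrite lee_fin.
rewrite (nneseries_split 0 n.+1); last by move=> i _; exact: hausdorff_gauge_ge0.
rewrite [X in (_ + X)%E]eseries0 ?adde0; last first.
  by move=> i ni _; rewrite Ubig // /hausdorff_gauge eqxx.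
have gU i : (hausdorff_gauge s (U i) <= ((n%:R^-1) `^ s)%:E)%E.
  rewrite /hausdorff_gauge; case: ifP => _; first by rewrite lee_fin powR_ge0.
  rewrite -poweR_EFin; apply: gt0_ler_poweR => //; first by lra.
  - by rewrite in_itv /= diam_ge0 leey.
  - by rewrite in_itv /= leey andbT lee_fin invr_ge0 ltW.
apply: (@le_trans _ _ (\sum_(0 <= i < n.+1) ((n%:R^-1) `^ s)%:E)%E).
  by apply: lee_sum => i _; exact: gU.
rewrite sumEFin lee_fin sumr_const_nat subn0 -[_ *+ n.+1]mulr_natl.
have n1 : n.+1%:R <= 2 * n%:R :> R by rewrite -natrM ler_nat mul2n -addnn -addn1 leq_add2l.
apply: le_trans (ler_wpM2r (powR_ge0 _ _) n1) _; rewrite -mulrA; lra.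
Qed.

(** * Pierce series *)

Definition pierce_term (R : realType) (d : nat -> nat) (k : nat) : R :=
  (-1) ^+ k / (\prod_(i < k.+1) d i)%:R.

(** The number whose Pierce expansion has the digits [d 0, d 1, ...]. *)
Definition pierce_sum (R : realType) (d : nat -> nat) : R :=
  limn (series (pierce_term R d)).

(** Such a sequence is strictly increasing, hence a digit sequence; the factor [2]
makes the convergence of the series geometric. *)
Definition doubling (d : nat -> nat) :=
  (0 < d 0%N)%N /\ forall n, ((d n).*2 <= d n.+1)%N.

Lemma doubling_gt0 (d : nat -> nat) (n : nat) : doubling d -> (0 < d n)%N.
Proof.
by move=> [d0 dS]; elim: n => // n IH; apply: leq_trans (dS n); rewrite double_gt0.
Qed.

Lemma doubling_shift (d : nat -> nat) : doubling d -> doubling (d \o S).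
Proof.
by move=> Dd; split=> [|n] /=; [exact: doubling_gt0|case: Dd => _ ->].
Qed.

Lemma doubling_ge_expn (d : nat -> nat) (n : nat) : doubling d -> (2 ^ n <= d n)%N.
Proof.
move=> [d0 dS]; elim: n => // n IH; apply: leq_trans (dS n).
by rewrite expnS mul2n leq_double.
Qed.

Lemma cvg_pierce_sum (R : realType) (d : nat -> nat) : doubling d ->
  cvgn (series (pierce_term R d)).
Proof.
move=> Dd; apply: normed_cvg => /=.
apply: (@series_le_cvg _ _ (geometric 1 2^-1)) => [n|n|n|].
- exact: normr_ge0.
- by rewrite /= mul1r exprn_ge0 // invr_ge0.
- have le2P : (2 ^ n <= \prod_(i < n.+1) d i)%N.
    elim: n => [|n IH]; first by rewrite big_ord1; case: Dd.
    rewrite expnSr big_ord_recr leq_mul //.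
    exact: leq_trans (leq_pexp2l _ (ltn0Sn n)) (doubling_ge_expn _ n.+1 Dd).
  rewrite /= /pierce_term normrM normrX normrN1 expr1n !mul1r normfV normr_nat.
  rewrite exprVn lef_pV2 ?posrE ?exprn_gt0 ?ltr0n ?ltr0Sn //.
    by rewrite -natrX ler_nat.
  exact: leq_trans (expn_gt0 2 n) le2P.
- by apply: is_cvg_geometric_series; rewrite ger0_norm; lra.
Qed.

Lemma pierce_partial_sumS (R : realType) (d : nat -> nat) (n : nat) :
  series (pierce_term R d) n.+1 =
  (1 - series (pierce_term R (d \o S)) n) /
    (d 0%N)%:R.
Proof.
rewrite /series /= big_nat_recl // {1}/pierce_term big_ord1 expr0 mul1r mulrBl mul1r; congr (_ + _).
rewrite mulr_suml -sumrN; apply: eq_bigr => k _.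
rewrite /pierce_term big_ord_recl /= natrM invfM exprS.
by rewrite mulN1r mulNr mulrCA mulrC.
Qed.

Lemma pierce_partial_sum_01 (R : realType) (d : nat -> nat) (n : nat) :
  doubling d ->
  0 <= series (pierce_term R d) n <= 1.
Proof.
elim: n d => [|n IH] d Dd; first by rewrite /series /= big_geq // lexx ler01.
rewrite pierce_partial_sumS; have := IH _ (doubling_shift _ Dd).
set z := series _ _ => z01; have d1 : 1 <= (d 0%N)%:R :> R by rewrite ler1n; case: Dd.
rewrite divr_ge0 ?ler_pdivrMr //; lra.
Qed.

Lemma pierce_sum_01 (R : realType) (d : nat -> nat) :
  doubling d -> 0 <= pierce_sum R d <= 1.
Proof.
move=> Dd; have c := @cvg_pierce_sum R d Dd; apply/andP; split.
  by apply: limr_ge => //; near=> n; have /andP[] := @pierce_partial_sum_01 R d n Dd.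
by apply: limr_le => //; near=> n; have /andP[] := @pierce_partial_sum_01 R d n Dd.
Unshelve. all: by end_near. Qed.

(** This recursion inverts [pierce_map]; the bounds, the digits and the
separation of these sums are all read off from it. *)
Lemma pierce_sumE (R : realType) (d : nat -> nat) : doubling d ->
  pierce_sum R d = (1 - pierce_sum R (d \o S)) / (d 0%N)%:R.
Proof.
move=> Dd; apply/cvg_lim => //; rewrite -(cvg_shiftS _).
under eq_fun do rewrite pierce_partial_sumS.
apply: cvgM; last exact: cvg_cst.
by apply: cvgB; [exact: cvg_cst|exact: cvg_pierce_sum (doubling_shift _ Dd)].
Qed.

Lemma pierce_sum_le_inv (R : realType) (d : nat -> nat) : doubling d ->
  pierce_sum R d <= (d 0%N)%:R^-1.
Proof.
move=> Dd; rewrite pierce_sumE // ler_piMl ?invr_ge0 //.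
by have := @pierce_sum_01 R _ (doubling_shift _ Dd); lra.
Qed.

(** The tail [y] is positive and less than [1 / d 1], which is at most
[1 / (d 0 + 1)]; so [(1 - y) / d 0] lies strictly between [1 / (d 0 + 1)] and
[1 / d 0]. *)
Lemma pierce_sum_bounds (R : realType) (d : nat -> nat) : doubling d ->
  (d 0%N).+1%:R^-1 < pierce_sum R d < (d 0%N)%:R^-1.
Proof.
move=> Dd; have D1 := doubling_shift _ Dd; have D2 := doubling_shift _ D1.
have d_gt0 e : doubling e -> 0 < (e 0%N)%:R :> R by rewrite ltr0n => -[].
have ge_inv e : doubling e -> (e 0%N).+1%:R^-1 <= pierce_sum R e.
  move=> De; have De1 := doubling_shift _ De; have e0 := d_gt0 _ De.
  have y_le : pierce_sum R (e \o S) <= (e 0%N).+1%:R^-1.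
    apply: le_trans (pierce_sum_le_inv _ _ De1) _.
    rewrite lef_pV2 ?posrE ?ltr0Sn ?d_gt0 // ler_nat.
    case: De => e1 eS; apply: leq_trans (eS 0%N).
    by rewrite -addnn -addn1 leq_add2l.
  rewrite pierce_sumE // ler_pdivlMr //.
  have -> : (e 0%N)%:R = (e 0%N).+1%:R - 1 :> R by rewrite -natr1 addrK.
  by rewrite mulrBr mulVf ?pnatr_eq0 // mulr1 lerD2l lerN2.
have gt0 e : doubling e -> 0 < pierce_sum R e.
  by move=> De; apply: lt_le_trans (ge_inv _ De); rewrite invr_gt0 ltr0Sn.
have lt_inv e : doubling e -> pierce_sum R e < (e 0%N)%:R^-1.
  move=> De; rewrite pierce_sumE // gtr_pMl ?invr_gt0 ?d_gt0 //.
  by have := gt0 _ (doubling_shift _ De); lra.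
rewrite lt_inv // andbT pierce_sumE // ltr_pdivlMr ?d_gt0 //.
have -> : (d 0%N)%:R = (d 0%N).+1%:R - 1 :> R by rewrite -natr1 addrK.
rewrite mulrBr mulVf ?pnatr_eq0 // mulr1 ltrD2l ltrN2.
apply: lt_le_trans (lt_inv _ D1) _.
rewrite lef_pV2 ?posrE ?ltr0Sn ?d_gt0 // ler_nat.
case: Dd => d1 dS; apply: leq_trans (dS 0%N).
by rewrite -addnn -addn1 leq_add2l.
Qed.

Lemma pierce_sum_gt0 (R : realType) (d : nat -> nat) : doubling d ->
  0 < pierce_sum R d.
Proof.
by move=> /(pierce_sum_bounds R) /andP[+ _]; apply: lt_trans; rewrite invr_gt0 ltr0Sn.
Qed.

Lemma pierce_digit1_sum (R : realType) (d : nat -> nat) : doubling d ->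
  pierce_digit1 (pierce_sum R d) = d 0%N.
Proof.
move=> Dd; have /andP[lb ub] := @pierce_sum_bounds R _ Dd.
have x0 := @pierce_sum_gt0 R _ Dd.
have d0 : 0 < (d 0%N)%:R :> R by rewrite ltr0n; case: Dd.
apply: floor_def; rewrite mul1r intrD -!pmulrn.
rewrite -lef_pV2 ?posrE ?invr_gt0 // invrK ltW //=.
by rewrite -ltf_pV2 ?posrE ?invr_gt0 ?addr_gt0 // invrK natr1.
Qed.

Lemma pierce_map_sum (R : realType) (d : nat -> nat) : doubling d ->
  pierce_map (pierce_sum R d) = pierce_sum R (d \o S).
Proof.
move=> Dd; rewrite /pierce_map pierce_digit1_sum // {1}pierce_sumE // -pmulrn.
by rewrite mulrC mulfVK ?pnatr_eq0 -?lt0n; [lra|case: Dd].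
Qed.

Lemma iter_pierce_map_sum (R : realType) (d : nat -> nat) (n : nat) :
  doubling d ->
  iter n (@pierce_map R) (pierce_sum R d) = pierce_sum R (fun k => d (k + n)%N)
  /\ doubling (fun k => d (k + n)%N).
Proof.
move=> Dd; elim: n => [|n [IH Dn]].
  by rewrite (_ : (fun k => _) = d) //; apply/funext => k; rewrite addn0.
rewrite (_ : (fun k => _) = (fun k => d (k + n)%N) \o S); last first.
  by apply/funext => k /=; rewrite addSnnS.
by split; [rewrite iterS IH pierce_map_sum|exact: doubling_shift].
Qed.

Lemma pierce_digit_sum (R : realType) (d : nat -> nat) (n : nat) :
  doubling d -> pierce_digit n.+1 (pierce_sum R d) = d n.
Proof.
move=> Dd; rewrite /pierce_digit /=.
by have [-> Dn] := iter_pierce_map_sum R d n Dd; rewrite pierce_digit1_sum.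
Qed.

(** If [b] is a denominator of the sum, then [b] times each iterate of the Pierce
map is a positive integer; but the [b]-th iterate is less than [1 / d b], which
is at most [1 / b]. *)
Lemma pierce_sum_irrational (R : realType) (d : nat -> nat) :
  doubling d -> irrational (pierce_sum R d).
Proof.
move=> Dd /rationalP[a [b xE]].
have b0 : (0 < b)%N.
  rewrite lt0n; apply/negP => /eqP b0; move: xE; rewrite b0 invr0 mulr0 => x0.
  by have := @pierce_sum_gt0 R _ Dd; rewrite x0 ltxx.
have bR : 0 < b%:R :> R by rewrite ltr0n.
have intP n : exists c : int, b%:R * iter n (@pierce_map R) (pierce_sum R d) = c%:~R.
  elim: n => [|n [c IH]].
    by exists a; rewrite /= xE mulrCA mulfV ?mulr1 ?gt_eqF.
  rewrite iterS /pierce_map; set y := iter _ _ _ in IH *.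
  exists (b%:Z - pierce_digit1 y * c).
  by rewrite rmorphB rmorphM /= -IH -pmulrn; ring.
have [c] := intP b; have [-> Dn] := iter_pierce_map_sum R d b Dd => cE.
have c_gt0 : (0 < c)%R.
  by rewrite -(ltr0z R) -cE mulr_gt0 // pierce_sum_gt0.
have : 1 <= c%:~R :> R by rewrite -[1]/(1%:~R) ler_int.
apply/negP; rewrite -ltNge -cE -ltr_pdivlMl // mulr1.
have /andP[_] := @pierce_sum_bounds R _ Dn; rewrite add0n => /lt_le_trans; apply.
rewrite lef_pV2 ?posrE // ?ltr0n ?ler_nat; last exact: (doubling_gt0 d b).
exact: leq_trans (ltnW (ltn_expl b (ltnSn 1))) (doubling_ge_expn d b Dd).
Qed.

(** Different first digits [i < j] give numbers [(1 - y) / i] and [(1 - y') / j]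
whose distance could be arbitrarily small for [j = i + 1] and [y] close to
[1 / j]; a second digit at least [2 * j] forces [y <= 1 / (2 * j)]. *)
Lemma pierce_sum_sep0 (R : realType) (d d' : nat -> nat) :
  doubling d -> doubling d' -> (d 0 < d' 0)%N -> ((d' 0).*2 <= d 1)%N ->
  (2 * (d 0%N)%:R * (d' 0%N)%:R)^-1 <= pierce_sum R d - pierce_sum R d'.
Proof.
move=> Dd Dd' lt_dd' d1.
have y_le : pierce_sum R (d \o S) <= (2 * (d' 0%N)%:R)^-1.
  apply: le_trans (pierce_sum_le_inv _ _ (doubling_shift _ Dd)) _ => /=.
  rewrite -natrM lef_pV2 ?posrE ?ltr0n ?muln_gt0 /=; first by rewrite ler_nat mul2n.
    exact: doubling_gt0.
  by case: Dd'.
have y'_ge0 := @pierce_sum_gt0 R _ (doubling_shift _ Dd').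
rewrite (pierce_sumE R d) // (pierce_sumE R d') //.
have i0 : 0 < (d 0%N)%:R :> R by rewrite ltr0n; case: Dd.
have lt_ij : (d 0%N)%:R + 1 <= (d' 0%N)%:R :> R by rewrite natr1 ler_nat.
move: y_le y'_ge0 i0 lt_ij.
set i := (d 0%N)%:R; set j := (d' 0%N)%:R; set y := pierce_sum _ _.
set y' := pierce_sum _ _ => y_le y'_gt0 i0 lt_ij.
have j0 : 0 < j by lra.
apply: (@le_trans _ _ ((1 - (2 * j)^-1) / i - 1 / j)).
  rewrite -subr_ge0.
  have -> : (1 - (2 * j)^-1) / i - 1 / j - (2 * i * j)^-1 = (j - i - 1) / (i * j).
    by field; rewrite !gt_eqF.
  by rewrite divr_ge0 ?mulr_ge0 //; lra.
apply: lerB; rewrite ler_wpM2r ?invr_ge0 ?(ltW i0) ?(ltW j0) //; lra.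
Qed.

(** The Pierce map expands by exactly the digit on a cylinder, which reduces a
difference at place [n] to a difference at place [0]. *)
Lemma pierce_sum_sep (R : realType) (d d' : nat -> nat) (b n : nat) :
  doubling d -> doubling d' -> (forall i, (i < n)%N -> d i = d' i) ->
  d n <> d' n -> (d n <= b)%N -> (d' n <= b)%N ->
  (b.*2 <= d n.+1)%N -> (b.*2 <= d' n.+1)%N ->
  (2 * b%:R ^+ 2 * (\prod_(i < n) d i)%:R)^-1 <=
    `|pierce_sum R d - pierce_sum R d'|.
Proof.
elim: n d d' => [|n IH] d d' Dd Dd' eqd nd db d'b bd bd'.
  rewrite big_ord0 mulr1.
  wlog lt_dd' : d d' Dd Dd' eqd nd db d'b bd bd' / (d 0 < d' 0)%N.
    move=> H; case: (ltngtP (d 0%N) (d' 0%N)) => [lt|lt|//]; first exact: H.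
    by rewrite distrC; apply: H => //; exact/nesym.
  have i0 : 0 < (d 0%N)%:R :> R by rewrite ltr0n; case: Dd.
  have j0 : 0 < (d' 0%N)%:R :> R by rewrite ltr0n; case: Dd'.
  apply: le_trans (ler_norm _).
  apply: le_trans (pierce_sum_sep0 _ _ _ Dd Dd' lt_dd' _); last first.
    by apply: leq_trans bd; rewrite leq_double.
  have b0 : 0 < b%:R :> R by apply: lt_le_trans i0 _; rewrite ler_nat.
  rewrite lef_pV2 ?posrE ?mulr_gt0 ?exprn_gt0 // -mulrA expr2.
  by rewrite ler_pM2l // ler_pM ?ler_nat // ltW.
have d0 : d 0%N = d' 0%N by exact: eqd.
have d0_gt0 : 0 < (d 0%N)%:R :> R by rewrite ltr0n; case: Dd.
have := IH (d \o S) (d' \o S) (doubling_shift _ Dd) (doubling_shift _ Dd')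
  (fun i lt_in => eqd i.+1 lt_in) nd db d'b bd bd'.
rewrite (pierce_sumE R d) // (pierce_sumE R d') // -d0 -mulrBl normrM normfV.
rewrite [`|(d 0%N)%:R|]gtr0_norm // (_ : forall x y : R, 1 - x - (1 - y) = y - x); last first.
  by move=> x y; ring.
rewrite distrC => H; rewrite big_ord_recl natrM mulrCA mulrC invfM.
by rewrite ler_pM2r // invr_gt0.
Qed.

(** * Mixed radix coding of a Cantor set of digit sequences *)

Fixpoint radix_rest (R : realType) (m : nat -> nat) (u : R) (n : nat) : R :=
  if n is k.+1 then
    (m k)%:R * radix_rest R m u k -
      (Num.truncn ((m k)%:R * radix_rest R m u k))%:R
  else u.

Definition radix_digit (R : realType) (m : nat -> nat) (u : R) (n : nat) : nat :=
  Num.truncn ((m n)%:R * radix_rest R m u n).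

Lemma radix_rest_01 (R : realType) (m : nat -> nat) (u : R) (n : nat) :
  0 <= u < 1 -> 0 <= radix_rest R m u n < 1.
Proof.
move=> u01; elim: n => //= n IH.
have y0 : 0 <= (m n)%:R * radix_rest R m u n by rewrite mulr_ge0 //; lra.
by have := truncn_itv y0; rewrite -natr1; lra.
Qed.

Lemma radix_digit_lt (R : realType) (m : nat -> nat) (u : R) (n : nat) :
  0 <= u < 1 -> (0 < m n)%N -> (radix_digit R m u n < m n)%N.
Proof.
move=> u01 mn; have r01 := radix_rest_01 R m u n u01.
have y0 : 0 <= (m n)%:R * radix_rest R m u n by rewrite mulr_ge0 //; lra.
rewrite -(ltr_nat R); have /andP[le_y _] := truncn_itv y0.
by apply: le_lt_trans le_y _; rewrite gtr_pMr ?ltr0n //; lra.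
Qed.

(** Subtracting equal digits, [u - v] is the difference of the [n]-th rests
divided by the product of the first [n] radices. *)
Lemma radix_digit_close (R : realType) (m : nat -> nat) (u v : R) (n : nat) :
  (forall i, (0 < m i)%N) -> 0 <= u < 1 -> 0 <= v < 1 ->
  (forall i, (i < n)%N -> radix_digit R m u i = radix_digit R m v i) ->
  `|u - v| <= (\prod_(i < n) m i)%:R^-1.
Proof.
move=> m0 u01 v01 eq_uv.
have -> : u - v = (\prod_(i < n) m i)%:R^-1 * (radix_rest R m u n - radix_rest R m v n).
  elim: n eq_uv => [|n IH] eq_uv; first by rewrite big_ord0 invr1 mul1r.
  rewrite IH => [|i i_n]; last exact/eq_uv/ltnW.
  have mn : (m n)%:R != 0 :> R by rewrite pnatr_eq0 -lt0n.
  rewrite big_ord_recr /= -/(radix_digit R m u n) -/(radix_digit R m v n) eq_uv //.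
  by rewrite natrM invfM; field; rewrite mn pnatr_eq0 -lt0n prodn_gt0.
rewrite normrM ger0_norm ?invr_ge0 // ler_piMr ?invr_ge0 //.
have := radix_rest_01 R m u n u01; have := radix_rest_01 R m v n v01.
by rewrite ler_norml; lra.
Qed.

Lemma gt0_lower_bound (R : realType) (Q : nat -> R) :
  (forall n, 0 < Q n) -> (\forall n \near \oo, Q n <= Q n.+1) ->
  exists2 c, 0 < c & forall n, c <= Q n.
Proof.
move=> Q0 [N _ QN].
have [c c0 cN] : exists2 c, 0 < c & forall n, (n <= N)%N -> c <= Q n.
  elim: N {QN} => [|N [c c0 cN]].
    by exists (Q 0%N) => // n; rewrite leqn0 => /eqP ->.
  exists (Num.min c (Q N.+1)); first by rewrite lt_min c0 Q0.
  move=> n; rewrite leq_eqVlt => /predU1P[->|/cN]; first by rewrite ge_min lexx orbT.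
  by move=> cn; rewrite ge_min cn.
exists c => // n; elim: n => [|n IH]; first exact: cN.
case: (leqP n.+1 N) => [/cN //|Nn].
exact: le_trans IH (QN n Nn).
Qed.

(** The lower end is excluded so that [a] and [m] can be integer parts of the
real bounds of a window. *)
Definition window (a m d : nat -> nat) := forall n, (a n < d n <= a n + m n)%N.

(** The Hoelder estimate compares [M n], the number of codes of length [n], with
[D n ^ p], where [1 / D n] is the distance between points whose digits first
differ at place [n].  The quotient [M n / D n ^ p] is multiplied at each step by
[m n] over the [p]-th power of [(b n.+1) ^ 2 / b n].  The third hypothesis
makes this factor at least [1] from some index on, so the quotient is bounded
away from [0]. *)
Lemma pierce_window_measure_gt0 (R : realType) (a m : nat -> nat) (s : R) :
  (forall n, (0 < m n)%N) ->
  (forall n, ((a n + m n).*2 <= (a n.+1).+1)%N) ->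
  (forall p : R, 0 < p < 1 -> \forall n \near \oo,
     ((a n.+1 + m n.+1)%:R ^+ 2 / (a n + m n)%:R) `^ p <= (m n)%:R) ->
  0 <= s < 1 ->
  (0 < hausdorff_measure s
     [set pierce_sum R d | d in [set d | doubling d /\ window a m d]])%E.
Proof.
move=> m0 aS mp s01.
(* The estimate is proved for a positive exponent [p] and then weakened to [s],
   which may be [0]: only for [p > 0] does it show that [G] is injective. *)
pose p := Num.max s 2^-1.
have [p0 p1 sp] : [/\ 0 < p, p < 1 & s <= p].
  by rewrite /p lt_max gt_max le_max lexx; split; lra.
pose b n := (a n + m n)%N.
pose w (u : R) n := ((a n).+1 + radix_digit R m u n)%N.
have w_window u : 0 <= u < 1 -> window a m (w u).
  move=> u01 n; rewrite /w addSn ltnS leq_addr /= -addnS leq_add2l.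
  exact: radix_digit_lt.
have w_doubling u : 0 <= u < 1 -> doubling (w u).
  move=> u01; split=> [//|n].
  apply: (@leq_trans ((a n + m n).*2)); last first.
    by apply: leq_trans (aS n) _; exact: leq_addr.
  by rewrite leq_double; have /andP[] := w_window u u01 n.
have b_gt0 n : (0 < b n)%N by rewrite addn_gt0 m0 orbT.
have b_ge n : (2 ^ n <= b n)%N.
  have z01 : 0 <= (0 : R) < 1 by lra.
  apply: leq_trans (doubling_ge_expn _ n (w_doubling _ z01)) _.
  by have /andP[] := w_window _ z01 n.
pose M n := (\prod_(i < n) m i)%N.
pose D n : R := 2 * (b n)%:R ^+ 2 * (\prod_(i < n) b i)%:R.
have M_gt0 n : 0 < (M n)%:R :> R by rewrite ltr0n prodn_gt0.
have B_gt0 n : 0 < (\prod_(i < n) b i)%:R :> R by rewrite ltr0n prodn_gt0.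
have bR n : 0 < (b n)%:R :> R by rewrite ltr0n.
have D_gt0 n : 0 < D n by rewrite !mulr_gt0 ?exprn_gt0.
have [c c0 cQ] : exists2 c, 0 < c & forall n, c <= (M n)%:R / D n `^ p.
  apply: gt0_lower_bound => [n|]; first by rewrite divr_gt0 ?powR_gt0.
  have pp : 0 < p < 1 by rewrite p0.
  apply: filterS (mp p pp) => n; rewrite -/(b n) -/(b n.+1) => le_m.
  have -> : D n.+1 = D n * ((b n.+1)%:R ^+ 2 / (b n)%:R).
    rewrite /D big_ord_recr /= natrM; field; exact: lt0r_neq0.
  have r0 : 0 < (b n.+1)%:R ^+ 2 / (b n)%:R :> R by rewrite divr_gt0 ?exprn_gt0.
  rewrite powRM ?(ltW (D_gt0 _)) ?(ltW r0) // /M big_ord_recr natrM /= invfM mulrACA -/(M n).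
  rewrite ler_peMr ?divr_ge0 ?powR_ge0 ?ler0n //.
  by rewrite ler_pdivlMr ?powR_gt0 // mul1r.
have M_inv n : (M n)%:R^-1 <= c^-1 * (D n)^-1 `^ p.
  have Dp : 0 < D n `^ p by rewrite powR_gt0.
  rewrite -(powR_inv1 (ltW (D_gt0 n))) -powRrM mulN1r powRN -invfM.
  by rewrite lef_pV2 ?posrE ?mulr_gt0 // -ler_pdivlMr.
pose G u := pierce_sum R (w u).
apply: (@hausdorff_measure_gt0 _ _ _ c^-1 G); [lra|by rewrite invr_gt0| |].
  move=> u u01; exists (w u) => //; split; [exact: w_doubling|exact: w_window].
move=> u v u01 v01.
have Mle n : (forall i, (i < n)%N -> radix_digit R m u i = radix_digit R m v i) ->
    `|u - v| <= c^-1 * (D n)^-1 `^ p.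
  by move=> E; apply: le_trans (M_inv n); exact: radix_digit_close.
have [ex|same] := pselect (exists n, radix_digit R m u n != radix_digit R m v n).
  have [k nk min_k] := ex_minnP ex.
  have eqk i : (i < k)%N -> radix_digit R m u i = radix_digit R m v i.
    by move=> ik; apply/eqP; apply: contraTT ik => /min_k; rewrite -leqNgt.
  have sep : (D k)^-1 <= `|G u - G v|.
    apply: le_trans (pierce_sum_sep R (w u) (w v) (b k) k (w_doubling _ u01)
      (w_doubling _ v01) _ _ _ _ _ _); first last.
    - by apply: leq_trans (aS k) _; exact: leq_addr.
    - by apply: leq_trans (aS k) _; exact: leq_addr.
    - by have /andP[] := w_window _ v01 k.
    - by have /andP[] := w_window _ u01 k.
    - by move/addnI/eqP; apply/negP.
    - by move=> i /eqk E; rewrite /w E.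
    rewrite lef_pV2 ?posrE ?mulr_gt0 ?exprn_gt0 ?ltr0n ?prodn_gt0 //.
    rewrite ler_pM2l ?mulr_gt0 ?exprn_gt0 // ler_nat.
    by apply: leq_prod => i _; have /andP[] := w_window _ u01 i.
  have G_gt0 : 0 < `|G u - G v| by apply: lt_le_trans sep; rewrite invr_gt0.
  have G_le1 : `|G u - G v| <= 1.
    have := @pierce_sum_01 R _ (w_doubling _ u01).
    have := @pierce_sum_01 R _ (w_doubling _ v01).
    by rewrite -/(G u) -/(G v) ler_norml; lra.
  apply: le_trans (Mle k eqk) _; rewrite ler_pM2l ?invr_gt0 //.
  apply: (@le_trans _ _ (`|G u - G v| `^ p)); last by rewrite ger_powR // G_gt0.
  by rewrite ge0_ler_powR ?nnegrE ?invr_ge0 // ltW.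
(* With equal codes, the bounds [c^-1 * (D n)^-1 ^ p] on [`|u - v|] tend to [0]
   because [D n] grows. *)
suff -> : u = v by rewrite subrr normr0 mulr_ge0 ?invr_ge0 ?powR_ge0 // ltW.
apply/eqP; rewrite -subr_eq0 -normr_le0; apply/ler_addgt0Pr => e e0; rewrite add0r.
pose y := (c * e) `^ p^-1.
have y0 : 0 < y by rewrite powR_gt0 // mulr_gt0.
have /cvgrPdist_le /(_ _ y0) [n _ Hn] := @cvg_harmonic R.
have := Hn n (leqnn n); rewrite /= sub0r normrN ger0_norm // => ny.
apply: le_trans (Mle n _) _.
  by move=> i _; apply/eqP; apply: contra_notT same => ?; exists i.
rewrite ler_pdivrMl //.
have -> : c * e = y `^ p.
  by rewrite -powRrM mulVf ?powRr1 ?gt_eqF // mulr_ge0 // ltW.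
apply: ge0_ler_powR; rewrite ?nnegrE ?invr_ge0 ?(ltW p0) ?(ltW y0) ?(ltW (D_gt0 n)) //.
apply: le_trans ny; rewrite lef_pV2 ?posrE ?ltr0Sn //.
have nb : n.+1%:R <= (b n)%:R :> R.
  by rewrite ler_nat; apply: leq_trans (b_ge n); exact: ltn_expl.
have b1 : 1 <= (b n)%:R :> R by rewrite ler1n.
have B1 : 1 <= (\prod_(i < n) b i)%:R :> R by rewrite ler1n prodn_gt0.
have bb : (b n)%:R <= (b n)%:R ^+ 2 :> R by rewrite expr2; nra.
apply: le_trans nb _; rewrite /D.
set B := (\prod_(i < n) b i)%:R in B1 *; nra.
Qed.

(** * Digits prescribed up to a small relative error *)

(** Cesaro's lemma applied to the increments. *)
Lemma cvg_div_of_increment (R : realType) (u : nat -> R) (l : R) :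
  u n.+1 - u n @[n --> \oo] --> l -> u n / n%:R @[n --> \oo] --> l.
Proof.
move=> /cesaro; rewrite -(cvg_shiftS (fun n => u n / n%:R)) => H.
have u0 : u 0%N * n.+1%:R^-1 @[n --> \oo] --> 0.
  by rewrite -[X in _ --> X](mulr0 (u 0%N)); apply: cvgM; [exact: cvg_cst|exact: cvg_harmonic].
rewrite -[l]addr0; apply: cvg_trans (cvgD H u0); apply: near_eq_cvg.
near=> n; rewrite /arithmetic_mean /= telescopeK /=.
by rewrite fctE /=; ring.
Unshelve. all: by end_near. Qed.

Lemma expR1_gt (R : realType) : 9 / 4 < expR 1 :> R.
Proof.
have h : 3 / 2 < expR 2^-1 :> R.
  have := @expR_gt1Dx R (2^-1); rewrite invr_eq0 pnatr_eq0 => /(_ isT).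
  by apply: le_lt_trans; lra.
rewrite [X in expR X](splitr 1) div1r expRD.
have -> : 9 / 4 = 3 / 2 * (3 / 2) :> R by field.
by apply: ltr_pM => //; lra.
Qed.

Definition pierce_tube (R : realType) (t w : nat -> R) : set R :=
  [set x : R | [/\ 0 < x <= 1, irrational x &
    \forall n \near \oo,
      expR (t n) < (pierce_digit n x)%:~R <= expR (t n) * (1 + w n)]].

(** The integers from [expR (t n)] to [expR (t n) * (1 + w n)] form the window
for the [n]-th digit once [n] is large.  Since [t n] grows like [n], their number
[expR (t n) * w n] eventually exceeds any multiple of [expR (p * t n)] with
[p < 1], which is the count required for dimension [1]. *)
Lemma pierce_tube_measure_gt0 (R : realType) (t w : nat -> R) (s : R) :
  t n.+1 - t n @[n --> \oo] --> (1 : R) ->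
  w n @[n --> \oo] --> 0 ->
  (forall p : R, 0 < p -> expR (p * n%:R) * w n @[n --> \oo] --> +oo) ->
  0 <= s < 1 ->
  (0 < hausdorff_measure s (pierce_tube R t w))%E.
Proof.
move=> t1 w0 wexp s01.
pose E n := expR (t n).
have E0 n : 0 < E n by exact: expR_gt0.
pose K : R := expR 1 + 1.
have K1 : 1 <= K by have := @expR_gt0 R 1; rewrite /K; lra.
have Estep : \forall n \near \oo, 9 / 4 * E n <= E n.+1 <= K * E n.
  have c : expR (t n.+1 - t n) @[n --> \oo] --> expR (1 : R).
    by apply: continuous_cvg => //; exact: continuous_expR.
  near=> n.
  have -> : E n.+1 = expR (t n.+1 - t n) * E n.
    by rewrite /E -expRD subrK.
  rewrite !ler_pM2r //; apply/andP; split; near: n.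
    exact: cvgr_ge c _ (expR1_gt R).
  by apply: cvgr_le c _ _; rewrite /K; lra.
have ln2_lt1 : ln 2 < 1 :> R.
  rewrite -ltr_expR lnK ?posrE //; have := expR1_gt R; lra.
have t_lb : \forall n \near \oo, ln 2 * n%:R <= t n.
  have c := cvg_div_of_increment _ _ _ t1.
  near=> n; have n0 : 0 < n%:R :> R by rewrite ltr0n; near: n; exact: nbhs_infty_gt.
  by rewrite -ler_pdivlMr //; near: n; exact: cvgr_ge c _ ln2_lt1.
have E_ge2 : \forall n \near \oo, 2 ^+ n <= E n.
  apply: filterS t_lb => n tn; rewrite /E.
  by rewrite -[X in X ^+ _](@lnK R 2) ?posrE // -expRM_natr ler_expR.
have wE p C : 0 < p -> \forall n \near \oo, C <= expR (p * t n) * w n.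
  move=> p0; have l0 : 0 < ln 2 :> R by rewrite ln_gt0 // ltr1n.
  have /cvgryPge/(_ (Num.max C 0)) := wexp _ (mulr_gt0 p0 l0).
  apply: filterS2 t_lb => n tn; rewrite ge_max => /andP[C1 C2].
  have wn : 0 <= w n by rewrite pmulr_rge0 ?expR_gt0 in C2.
  apply: le_trans C1 _; rewrite ler_wpM2r // ler_expR -mulrA ler_pM2l //.
have [N _ HN] : \forall n \near \oo, [/\ 9 / 4 * E n <= E n.+1, 2 ^+ n <= E n,
    w n <= 8^-1 & 1 <= E n * w n].
  near=> n; split.
  - suff /andP[] : 9 / 4 * E n <= E n.+1 <= K * E n by [].
    by near: n; exact: Estep.
  - by near: n; exact: E_ge2.
  - by near: n; apply: cvgr_le w0 _ _; lra.
  - rewrite /E -[t n]mul1r; near: n; exact: wE.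
(* Place [i] of the coding carries digit number [i + 1].  For [i < N] the window
   is the single integer [2 ^ i]; since [E n >= 2 ^ n], the growing windows can
   start right after these digits. *)
pose a i := if (i < N)%N then (2 ^ i).-1 else Num.truncn (E i.+1).
pose m i := if (i < N)%N then 1%N else Num.truncn (E i.+1 * w i.+1).
have b_lt i : (i < N)%N -> (a i + m i)%N = (2 ^ i)%N.
  by move=> iN; rewrite /a /m iN addn1 prednK // expn_gt0.
have aE i : (N <= i)%N -> a i = Num.truncn (E i.+1) by rewrite /a ltnNge => ->.
have mE i : (N <= i)%N -> m i = Num.truncn (E i.+1 * w i.+1).
  by rewrite /m ltnNge => ->.
have Ew_ge0 i : (N <= i)%N -> 0 <= E i.+1 * w i.+1.
  move=> iN; have [_ _ _] := HN i.+1 (leq_trans iN (leqnSn i)); lra.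
have b_ge i : (N <= i)%N -> (a i + m i)%:R <= E i.+1 * (1 + w i.+1).
  move=> iN; rewrite aE // mE // natrD mulrDr mulr1 lerD //.
    by rewrite truncn_le // ltW.
  by rewrite truncn_le // Ew_ge0.
have m_gt0 i : (0 < m i)%N.
  rewrite /m; case: (ltnP i N) => // iN; rewrite truncn_gt0.
  by have [] := HN i.+1 (leq_trans iN (leqnSn i)).
have aS i : ((a i + m i).*2 <= (a i.+1).+1)%N.
  have [iN|Ni] := ltnP i N.
    rewrite b_lt // -mul2n -expnS /a; case: (ltnP i.+1 N) => [_|Ni].
      by rewrite prednK // expn_gt0.
    apply: leq_trans (leqnSn _); rewrite truncn_ge_nat ?(ltW (E0 _)) // natrX.
    have [_ Ei _ _] := HN i.+2 (leq_trans Ni (leqnSn _)).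
        by apply: le_trans Ei; rewrite ler_eXn2l // ltr1n.
  apply: leq_trans (leqnSn _); rewrite (aE i.+1 (leq_trans Ni (leqnSn i))).
  rewrite truncn_ge_nat ?(ltW (E0 _)) // -mul2n natrM.
  have [e1 _ w8 _] := HN i.+1 (leq_trans Ni (leqnSn i)).
  have := b_ge i Ni; have := E0 i.+1; nra.
have mp p : 0 < p < 1 -> \forall n \near \oo,
    ((a n.+1 + m n.+1)%:R ^+ 2 / (a n + m n)%:R) `^ p <= (m n)%:R :> R.
  move=> /andP[p0 p1].
  have q0 : 0 < 1 - p by lra.
  have [M _ HM] : \forall n \near \oo, [/\ E n.+1 <= K * E n,
      16 * K ^+ 2 <= expR ((1 - p) * t n) * w n & 2 <= E n * w n].
    near=> n; split.
    - suff /andP[] : 9 / 4 * E n <= E n.+1 <= K * E n by [].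
      by near: n; exact: Estep.
    - by near: n; exact: wE.
    - rewrite /E -[t n]mul1r; near: n; exact: wE.
  exists (maxn N M) => // n /=; rewrite geq_max => /andP[Nn Mn].
  have [k1 k2 k3] := HM n.+1 (leq_trans Mn (leqnSn n)).
  have [_ e2 _ _] := HN n.+1 (leq_trans Nn (leqnSn n)).
  have [_ _ w8 _] := HN n.+2 (leq_trans Nn (leq_trans (leqnSn _) (leqnSn _))).
  have E2 : 2 <= E n.+1.
    by apply: le_trans e2; rewrite exprS ler_peMr // exprn_ege1 // ler1n.
  have ub : (a n.+1 + m n.+1)%:R <= 2 * K * E n.+1.
    apply: le_trans (b_ge n.+1 (leq_trans Nn (leqnSn n))) _.
    have := E0 n.+2; nra.
  have lb : E n.+1 / 2 <= (a n + m n)%:R.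
    have : E n.+1 < (a n).+1%:R by rewrite aE // truncnS_gt.
    by rewrite natrD -natr1; have := ler0n R (m n); lra.
  have b0 : 0 < (a n + m n)%:R :> R by rewrite ltr0n addn_gt0 m_gt0 orbT.
  (* The ratio of the next upper bound squared to the present one is, up to a
     constant, the size [E n.+1] of the present digit. *)
  have ratio : (a n.+1 + m n.+1)%:R ^+ 2 / (a n + m n)%:R <= 8 * K ^+ 2 * E n.+1.
    rewrite ler_pdivrMr //.
    apply: (@le_trans _ _ ((2 * K * E n.+1) ^+ 2)).
      by rewrite lerXn2r ?nnegrE // (le_trans _ ub).
    apply: (@le_trans _ _ (8 * K ^+ 2 * E n.+1 * (E n.+1 / 2))).
      by rewrite le_eqVlt; apply/orP; left; apply/eqP; field.
    by rewrite ler_pM2l // !mulr_gt0 ?exprn_gt0 //; lra.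
  have K2 : 1 <= 8 * K ^+ 2 by rewrite expr2; nra.
  apply: (@le_trans _ _ ((8 * K ^+ 2 * E n.+1) `^ p)).
    by apply: ge0_ler_powR; rewrite ?nnegrE ?divr_ge0 ?exprn_ge0 ?mulr_ge0 //; lra.
  rewrite powRM ?(ltW (E0 _)) //; last by lra.
  apply: (@le_trans _ _ (8 * K ^+ 2 * expR (p * t n.+1))).
    rewrite /E -expRM [t n.+1 * p]mulrC ler_pM2r ?expR_gt0 //.
    by apply: ler1_powR => //; lra.
  have : E n.+1 * w n.+1 < (m n).+1%:R by rewrite mE // truncnS_gt.
  rewrite -natr1.
  have : 8 * K ^+ 2 * expR (p * t n.+1) <= E n.+1 * w n.+1 / 2.
    have -> : E n.+1 = expR (p * t n.+1) * expR ((1 - p) * t n.+1).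
      by rewrite /E -expRD; congr expR; ring.
    rewrite mulrC -!mulrA ler_pM2l ?expR_gt0 // mulrA; lra.
  lra.
apply: lt_le_trans (pierce_window_measure_gt0 R a m s m_gt0 aS mp s01) _.
apply: le_hausdorff_measure => _ [d [Dd win] <-]; split.
- by rewrite pierce_sum_gt0 //; have /andP[] := @pierce_sum_01 R _ Dd.
- exact: pierce_sum_irrational.
- exists N.+1 => //= -[//|n] /= Nn; rewrite ltnS in Nn; rewrite pierce_digit_sum // -pmulrn.
  have /andP[d1 d2] := win n; apply/andP; split.
    have : E n.+1 < (a n).+1%:R by rewrite aE // truncnS_gt.
    by move=> /lt_le_trans; apply; rewrite ler_nat.
  by apply: le_trans (b_ge n Nn); rewrite ler_nat.
Unshelve. all: by end_near. Qed.

(** * The growth sets *)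

(** With relative error [psi n / n], the logarithm of the digit is off by at most
[psi n / n], hence by at most [1 / n] after division by [psi n]. *)
Lemma pierce_tube_sub_growth_set (R : realType) (psi : nat -> R) (b : R) :
  (forall n : nat, (0 < n)%N -> 0 < psi n) ->
  pierce_tube R (fun n => n%:R + b * psi n) (fun n => psi n / n%:R) `<=`
    pierce_growth_set psi b%:E.
Proof.
move=> psi0 x [x01 irr tube]; split=> //; apply/cvg_EFin; first exact: nearW.
rewrite -[b]addr0.
apply: (@squeeze_cvgr _ _ _ _ (fun=> b + 0) (fun n => b + n%:R^-1)).
- near=> n.
  have n0 : (0 < n)%N by near: n; exact: nbhs_infty_gt.
  have nR : 0 < n%:R :> R by rewrite ltr0n.
  have p0 := psi0 n n0.
  have : expR (n%:R + b * psi n) < (pierce_digit n x)%:~R <=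
      expR (n%:R + b * psi n) * (1 + psi n / n%:R) by near: n.
  move=> /andP[lb ub].
  have d0 : 0 < (pierce_digit n x)%:~R :> R by apply: lt_trans lb; exact: expR_gt0.
  have w0 : 0 < psi n / n%:R by rewrite divr_gt0.
  have lb' : n%:R + b * psi n <= ln (pierce_digit n x)%:~R.
    by rewrite -[leLHS]expRK ler_ln ?posrE ?expR_gt0 // ltW.
  have ub' : ln (pierce_digit n x)%:~R <= n%:R + b * psi n + psi n / n%:R.
    apply: (@le_trans _ _ (ln (expR (n%:R + b * psi n) * (1 + psi n / n%:R)))).
      by rewrite ler_ln ?posrE ?mulr_gt0 ?expR_gt0 ?addr_gt0.
    rewrite lnM ?posrE ?expR_gt0 ?addr_gt0 // expRK lerD2l le_ln1Dx //; lra.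
  rewrite /= addr0 ler_pdivlMr // ler_pdivrMr // mulrDl [n%:R^-1 * _]mulrC.
  by apply/andP; split; lra.
- exact: cvg_cst.
- apply: cvgD; first exact: cvg_cst.
  by rewrite -(cvg_shiftS (fun n => n%:R^-1 : R)); exact: cvg_harmonic.
Unshelve. all: by end_near. Qed.

Lemma hausdorff_dim_growth_set_ge1 (R : realType) (psi : nat -> R) (b : R) :
  (forall n : nat, (0 < n)%N -> 0 < psi n) ->
  psi n.+1 - psi n @[n --> \oo] --> (0 : R) ->
  (forall p : R, 0 < p -> expR (p * n%:R) * psi n @[n --> \oo] --> +oo) ->
  (1 <= hausdorff_dim (pierce_growth_set psi b%:E))%E.
Proof.
move=> psi0 slow decay; apply: le_ereal_inf_tmp => _ [s [s0 Hs] <-].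
rewrite lee_fin leNgt; apply/negP => s1.
suff : (0 < hausdorff_measure s (pierce_growth_set psi b%:E))%E by rewrite Hs ltxx.
have sub := @pierce_tube_sub_growth_set R psi b psi0.
apply: lt_le_trans (@le_hausdorff_measure R s _ _ sub).
apply: pierce_tube_measure_gt0; last by rewrite s0.
- have : 1 + b * (psi n.+1 - psi n) @[n --> \oo] --> 1 + b * 0.
    by apply: cvgD; [exact: cvg_cst|apply: cvgM => //; exact: cvg_cst].
  rewrite mulr0 addr0; apply: cvg_trans; apply: near_eq_cvg; apply: nearW => n.
  by rewrite -natr1; ring.
- exact: cvg_div_of_increment slow.
- move=> p p0; have q0 : 0 < p / 2 by lra.
  apply/cvgryPge => A; have /cvgryPge/(_ (2 / p * A)) := decay _ q0.
  apply: filterS2 (nbhs_infty_gt 0) => n n0 HA.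
  have nR : 0 < n%:R :> R by rewrite ltr0n.
  have pn := psi0 n n0.
  set e := expR (p / 2 * n%:R) in HA.
  have -> : expR (p * n%:R) = e * e by rewrite -expRD; congr expR; field.
  (* One of the two factors [expR (p / 2 * n)] absorbs the denominator [n]. *)
  have en : p / 2 * n%:R <= e by have := expR_ge1Dx (p / 2 * n%:R); rewrite -/e; lra.
  rewrite mulrA ler_pdivlMr //.
  have e0 : 0 < e by exact: expR_gt0.
  apply: (@le_trans _ _ ((p / 2 * n%:R) * (e * psi n))); last first.
    by rewrite -[leRHS]mulrA ler_pM2r // mulr_gt0.
  have -> : A * n%:R = (p / 2 * n%:R) * (2 / p * A) by field; rewrite gt_eqF.
  by rewrite ler_pM2l // mulr_gt0.
Qed.

(** The increments of [phi] are the square roots of those of [psi] in absolute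
value: they still tend to [0], but are infinitely larger.  The harmonic terms
make [phi] unbounded, so that the initial values of [psi] are negligible. *)
Lemma exists_faster_slow_sequence (R : realType) (psi : nat -> R) :
  psi n.+1 - psi n @[n --> \oo] --> (0 : R) ->
  exists phi : nat -> R, [/\ (forall n, 1 <= phi n),
    phi n.+1 - phi n @[n --> \oo] --> (0 : R) &
    psi n / phi n @[n --> \oo] --> (0 : R)].
Proof.
move=> slow.
pose dpsi n : R := `|psi n.+1 - psi n|.
pose phi n : R := 1 + series (fun k => Num.sqrt (dpsi k) + harmonic k) n.
have phiS n : phi n.+1 = phi n + (Num.sqrt (dpsi n) + harmonic n).
  by rewrite /phi seriesSr addrA.
have phi1 n : 1 <= phi n.
  rewrite /phi lerDl sumr_ge0 // => k _.
  by rewrite addr_ge0 ?sqrtr_ge0 // harmonic_ge0.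
exists phi; split=> //.
  have s0 : Num.sqrt (dpsi n) @[n --> \oo] --> (0 : R).
    have d0 : dpsi n @[n --> \oo] --> (0 : R).
      by rewrite -(@normr0 _ R); apply: cvg_norm.
    rewrite -(@sqrtr0 R); apply: continuous_cvg => //; exact: sqrt_continuous.
  rewrite (_ : (fun n => _) = (fun n => Num.sqrt (dpsi n)) + @harmonic R).
    by rewrite -[X in _ --> X]addr0; exact: cvgD s0 (@cvg_harmonic R).
  by apply/funext => n; rewrite phiS addrAC subrr add0r.
have phi_y : phi n @[n --> \oo] --> +oo.
  have hy : series (@harmonic R) n @[n --> \oo] --> +oo.
    apply: nondecreasing_dvgn_lt; last exact: dvg_harmonic.
    by apply: nondecreasing_series => n _ _; exact: harmonic_ge0.
  apply/cvgryPge => A; have /cvgryPge/(_ A) := hy; apply: filterS => n /le_trans.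
  apply; apply: (@le_trans _ _ (0 + series harmonic n)); first by rewrite add0r.
  by apply: lerD => //; apply: ler_sum => k _; rewrite lerDr sqrtr_ge0.
apply/cvgrPdist_le => e e0.
have d0 : \forall n \near \oo, dpsi n <= (e / 2) ^+ 2.
  have /cvgrPdist_le/(_ ((e / 2) ^+ 2)) := slow.
  rewrite exprn_gt0 ?divr_gt0 // => /(_ isT); apply: filterS => n.
  by rewrite sub0r normrN.
have [N _ HN] := d0.
have bound n : (N <= n)%N -> `|psi n| <= `|psi N| + e / 2 * phi n.
  have ephi k : 0 <= e / 2 * phi k.
    by have := phi1 k; nra.
  elim: n => [|n IH]; first by rewrite leqn0 => /eqP ->; rewrite lerDl.
  rewrite leq_eqVlt => /predU1P[<-|Nn]; first by rewrite lerDl.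
  have {}IH := IH Nn.
  have sq : dpsi n <= e / 2 * Num.sqrt (dpsi n).
    rewrite -{1}(@sqr_sqrtr _ (dpsi n)) ?normr_ge0 // expr2 ler_wpM2r ?sqrtr_ge0 //.
    rewrite -(@ger0_norm _ (e / 2)) ?divr_ge0 ?(ltW e0) // -sqrtr_sqr.
    by apply: ler_wsqrtr; exact: HN.
  have := ler_normD (psi n) (psi n.+1 - psi n); rewrite subrKC -/(dpsi n) => tri.
  rewrite phiS; have := @harmonic_ge0 R n; nra.
have /cvgryPge/(_ (2 / e * `|psi N|)) := phi_y.
apply: filterS2 (nbhs_infty_ge N) => n Nn phin.
have p0 : 0 < phi n by apply: lt_le_trans (phi1 n).
rewrite sub0r normrN normrM normfV (gtr0_norm p0) ler_pdivrMr //.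
apply: le_trans (bound n Nn) _.
have : `|psi N| <= e / 2 * phi n.
  rewrite -ler_pdivrMl ?divr_gt0 // invf_div //.
lra.
Qed.

Lemma cvg_div_faster (R : realType) (psi phi v : nat -> R) :
  (forall n : nat, (0 < n)%N -> 0 < psi n) -> (forall n, 0 < phi n) ->
  psi n / phi n @[n --> \oo] --> (0 : R) -> v n / phi n @[n --> \oo] --> (1 : R) ->
  v n / psi n @[n --> \oo] --> +oo.
Proof.
move=> psi0 phi0 small v1; apply/cvgryPge => A.
pose B := Num.max A 1.
have B0 : 0 < B by rewrite lt_max ltr01 orbT.
near=> n.
have p0 : 0 < psi n by apply: psi0; near: n; exact: nbhs_infty_gt.
have q0 := phi0 n.
have h1 : psi n / phi n <= (2 * B)^-1.
  by near: n; apply: cvgr_le small _ _; rewrite invr_gt0 mulr_gt0.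
have h2 : 2^-1 <= v n / phi n.
  by near: n; apply: cvgr_ge v1 _ _; lra.
apply: (@le_trans _ _ B); first by rewrite le_max lexx.
rewrite ler_pdivlMr //.
rewrite ler_pdivrMr // in h1; rewrite ler_pdivlMr // in h2.
apply: le_trans h2; rewrite -ler_pdivlMl //.
by rewrite mulrA [B^-1 * _]mulrC -invfM.
Unshelve. all: by end_near. Qed.

Theorem theorem1p14 (R : realType) (psi : nat -> R)
  (psi_gt0 : forall n : nat, (0 < n)%N -> 0 < psi n)
  (psi_slow : psi n.+1 - psi n @[n --> \oo] --> 0)
  (psi_decay : forall p : R, 0 < p ->
    expR (p * n%:R) * psi n @[n --> \oo] --> +oo)
  (beta : \bar R) :
  hausdorff_dim (pierce_growth_set psi beta) = 1%E.
Proof.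
apply/eqP; rewrite eq_le; apply/andP; split.
  apply/lee_addgt0Pr => e e0; apply: ereal_inf_lbound; exists (1 + e) => //.
  split; first by lra.
  apply: hausdorff_measure_sub01_eq0; last by lra.
  by move=> x [x01 _ _] /=; lra.
have [phi [phi1 phi_slow phi_fast]] := exists_faster_slow_sequence R psi psi_slow.
have phi0 n : 0 < phi n by apply: lt_le_trans (phi1 n).
have phi_dim (b : R) : (1 <= hausdorff_dim (pierce_growth_set phi b%:E))%E.
  apply: hausdorff_dim_growth_set_ge1 => // p p0.
  apply/cvgryPge => A.
  near=> n; apply: (@le_trans _ _ (p * n%:R)).
    by rewrite -ler_pdivrMl //; near: n; exact: nbhs_infty_ger.
  have := expR_ge1Dx (p * n%:R); have := phi1 n; have := expR_gt0 (p * n%:R).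
  set e := expR _; nra.
case: beta => [b| |].
- exact: hausdorff_dim_growth_set_ge1.
- apply: le_trans (phi_dim 1) _; apply: le_hausdorff_dim => x [x01 irr H].
  split=> //; apply/cvgeryP; apply: cvg_div_faster phi_fast _ => //.
  exact: (fine_cvg H).
- apply: le_trans (phi_dim (- 1)) _; apply: le_hausdorff_dim => x [x01 irr H].
  split=> //; apply/cvgerNyP; apply/cvgNry.
  pose v n : R := n%:R - ln (pierce_digit n x)%:~R.
  have v1 : v n / phi n @[n --> \oo] --> (1 : R).
    rewrite (_ : (fun n => _) =
      - (fun n => (ln (pierce_digit n x)%:~R - n%:R) / phi n)).
      by rewrite -[X in _ --> X]opprK; exact: cvgN (fine_cvg H).
    by apply/funext => n; rewrite /v fctE -mulNr opprB.
  rewrite (_ : - _ = fun n => v n / psi n); first exact: cvg_div_faster v1.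
  by apply/funext => n; rewrite /v fctE -mulNr opprB.
Unshelve. all: by end_near. Qed.
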